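(* Let $r$ be a positive integer, let $a,b\in\mathbb{Z}$, and let $K=\mathbb{Q}(\theta)$ be a number field with $\theta$ a root of a monic irreducible polynomial $F(x)=x^{2^r}+ax+b\in\mathbb{Z}[x]$. If one of the following conditions holds: (1) $r\ge 3$, $a\equiv 4\pmod 8$ and $b\equiv 3\pmod 8$; (2) $r\ge 4$, $a\equiv 8\pmod{16}$ and $b\equiv 7\pmod{16}$; (3) $r\ge 3$ and $(a,b)\equiv(0,31)\pmod{32}$ or $(a,b)\equiv(16,15)\pmod{32}$ (componentwise); then $2$ is a prime common index divisor of $K$. In particular, if one of these conditions holds, then $K$ is not monogenic.
   Context: For a number field $K$, $\mathbb{Z}_K$ denotes its ring of integers. $K$ is called monogenic if there exists $\eta\in\mathbb{Z}_K$ with $\mathbb{Z}_K=\mathbb{Z}[\eta]$. For $\eta\in\mathbb{Z}_K$ with $K=\mathbb{Q}(\eta)$, $\mathrm{ind}(\eta)$ denotes the index $(\mathbb{Z}_K:\mathbb{Z}[\eta])$. The index of $K$ is $i(K)=\gcd\{\mathrm{ind}(\eta)\mid \eta\in\mathbb{Z}_K,\ K=\mathbb{Q}(\eta)\}$. A prime $p$ dividing $i(K)$ is called a prime common index divisor of $K$. The coefficient $a$ is allowed to be $0$. *)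

(* Defs.v *)
From HB Require Import structures.
From mathcomp Require Import all_boot all_order all_algebra all_field.
From mathcomp Require Import finmap all_classical.

Set Implicit Arguments.
Unset Strict Implicit.
Unset Printing Implicit Defensive.

Import GRing.Theory Num.Theory.

Local Open Scope classical_set_scope.
Local Open Scope ring_scope.

Section GroupIndex.
Variable V : zmodType.
Implicit Types A B : set V.

Definition cosets A B : set (set V) := [set [set x + y | y in B] | x in A].

(* [fset_set] sends infinite sets to the empty one, so an infinite index is 0. *)
Definition group_index A B : nat := #|` fset_set (cosets A B)|%fset.

End GroupIndex.

Definition is_gcd_set (S : set nat) (d : nat) : Prop :=
  (forall n, S n -> d %| n)%N /\
  (forall e, (forall n, S n -> e %| n) -> e %| d)%N.

(* Every set of naturals has exactly one gcd in this sense (0 for subsets of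
   {0}), so the default value of [xget] is never used. *)
Definition gcd_set (S : set nat) : nat := xget 0%N [set d | is_gcd_set S d].

(* A number field is a [fieldExtType rat], i.e. a finite extension of Q. *)
Section NumberField.
Variable K : fieldExtType rat.
Implicit Types eta : K.

Definition ring_of_integers : set K :=
  [set x | integralOver (intr : int -> K) x].

Definition Zadjoin eta : set K :=
  [set (map_poly (intr : int -> K) p).[eta] | p in [set: {poly int}]].

(* K = Q(eta) *)
Definition generates eta : Prop := <<1%VS; eta>>%VS = fullv.

Definition monogenic : Prop :=
  exists2 eta, ring_of_integers eta & ring_of_integers = Zadjoin eta.

Definition ind eta : nat := group_index ring_of_integers (Zadjoin eta).

Definition field_index : nat :=
  gcd_set [set ind eta | eta in
             [set eta | ring_of_integers eta /\ generates eta]].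

Definition prime_common_index_divisor (p : nat) : Prop :=
  prime p /\ (p %| field_index)%N.

End NumberField.

Definition trinomial (r : nat) (a b : int) : {poly int} :=
  'X^(2 ^ r) + a *: 'X + b%:P.

(* Main.v *)
(* An edge of the 2-adic Newton polygon of G(x) = F(x + eps), eps = 1 or -1,
   that has height 1 and horizontal length e yields a place of K above 2 with
   residue field F_2 at which t = theta - eps is a uniformizer and t^e / 2 is a
   unit.  Each of the three conditions provides three edges of distinct lengths,
   hence three distinct homomorphisms Z_K -> F_2.  If (Z_K : Z[eta]) were odd, a
   homomorphism Z_K -> F_2 would be determined by the image of eta, and there are
   only two possible images. *)
Require Import Defs.
From HB Require Import structures.
From mathcomp Require Import all_boot all_order all_algebra all_field.
From mathcomp Require Import finmap all_classical.
From mathcomp Require Import zify ring.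

Set Implicit Arguments.
Unset Strict Implicit.
Unset Printing Implicit Defensive.

Import GRing.Theory Num.Theory.

Local Open Scope classical_set_scope.
Local Open Scope ring_scope.

(** * Evaluation of polynomials in Z[X, W] *)

(** The place of an edge is built inside K, without completions: it is the localisation of Z[t, w],
    w = t^e / 2, at the kernel of t -> 0, w -> 1. The obstacle is that this map must be well
    defined: a polynomial in X and W that vanishes at (t, w) is only known to become, under W -> X^e
    / 2, a multiple of G in Q[X], with uncontrolled denominators. Normalising G along the edge gives
    E in Z[X, W] congruent to W^s (W + 1) modulo (2, X). Its root W = 1 is simple, which is also why
    t generates the maximal ideal. Distinct lengths separate the places only through t^e / 2, which
    need not be integral. That the homomorphisms on Z_K differ as well is derived from the
    primitivity of an integer polynomial, in place of ideal theory. *)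

(* The outer variable X is sent to t and the inner one, W, to w. *)
Definition ev2 (A : comNzRingType) (t w : A) : {poly {poly int}} -> A :=
  horner_eval t \o map_poly (horner_eval w \o map_poly intr).

HB.instance Definition _ (A : comNzRingType) (t w : A) :=
  GRing.RMorphism.copy (ev2 t w)
    (horner_eval t \o map_poly (horner_eval w \o map_poly intr)).

Lemma ev2X (A : comNzRingType) (t w : A) : ev2 t w 'X = t.
Proof. by rewrite /ev2 /= map_polyX /horner_eval hornerX. Qed.

Lemma ev2C (A : comNzRingType) (t w : A) (p : {poly int}) :
  ev2 t w p%:P = (map_poly intr p).[w].
Proof. by rewrite /ev2 /= map_polyC /= /horner_eval hornerC. Qed.

Lemma ev2W (A : comNzRingType) (t w : A) : ev2 t w 'X%:P = w.
Proof. by rewrite ev2C map_polyX hornerX. Qed.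

Lemma ev2_map (A : comNzRingType) (t w : A) (p : {poly int}) :
  ev2 t w (map_poly polyC p) = (map_poly intr p).[t].
Proof.
elim/poly_ind: p => [|p c IHp]; first by rewrite !rmorph0 horner0.
rewrite !(rmorphD, rmorphM) /= !map_polyX !map_polyC /= IHp ev2X ev2C.
by rewrite map_polyC !hornerE.
Qed.

Lemma ev2_morph (A B : comNzRingType) (f : {rmorphism A -> B}) (t w : A) P :
  f (ev2 t w P) = ev2 (f t) (f w) P.
Proof.
elim/poly_ind: P => [|P p IHP]; first by rewrite !rmorph0.
rewrite !(rmorphD, rmorphM) /= IHP !ev2X !ev2C; congr (_ + _).
rewrite -horner_map -map_poly_comp; congr (_.[_]).
by apply: eq_map_poly => c /=; rewrite rmorph_int.
Qed.

Lemma ev2_0 (A : comNzRingType) (w : A) P :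
  ev2 0 w P = (map_poly intr P`_0).[w].
Proof.
elim/poly_ind: P => [|P p _]; first by rewrite coef0 !rmorph0 horner0.
by rewrite rmorphD rmorphM /= ev2X ev2C mulr0 add0r coefD coefMX coefC add0r.
Qed.

Lemma horner_intX (A : comNzRingType) (p : {poly int}) :
  (map_poly (intr : int -> {poly A}) p).['X] = map_poly intr p.
Proof.
rewrite -[RHS]comp_polyXr; congr (_.[_]); rewrite -map_poly_comp.
by apply: eq_map_poly => c /=; rewrite -(rmorph_int polyC).
Qed.

(** * Reduction of Z[X, X^e / 2] modulo (2, X) *)

Lemma F2_cases (a : 'F_2) : a = 0 \/ a = 1.
Proof. by case: a => [[|[|[]]]] // ?; [left|right]; apply: val_inj. Qed.

Lemma intrF2_eq0 (n : int) : (n%:~R == 0 :> 'F_2) = (2 %| n)%Z.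
Proof. by rewrite -(dvdz_pcharf (pchar_Fp _)). Qed.

Lemma map_poly_F2_eq0 (p : {poly int}) :
  map_poly (intr : int -> 'F_2) p = 0 -> exists q, p = q *+ 2.
Proof.
move=> p0; exists (map_poly (fun c => (c %/ 2)%Z) p).
apply/polyP => i; rewrite coefMn coef_map_id0 ?div0z //.
have /dvdzP[c ->] : (2 %| p`_i)%Z.
  by rewrite -intrF2_eq0 -coef_map p0 coef0.
by rewrite mulzK // (mulr_natr c 2).
Qed.

(* [h] is the image of an element of Z[X, W] under W -> X^e / 2 that reduces to
   [g] modulo (2, X). *)
Definition gauss_reduces (e : nat) (h : {poly rat}) (g : {poly int}) : Prop :=
  forall k, exists2 z : int, 2 ^+ (k %/ e) * h`_k = z%:~R &
    (e %| k)%N -> (z = g`_(k %/ e) %[mod 2])%Z.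

Lemma gauss_reducesD e h1 g1 h2 g2 :
  gauss_reduces e h1 g1 -> gauss_reduces e h2 g2 ->
  gauss_reduces e (h1 + h2) (g1 + g2).
Proof.
move=> H1 H2 k; have [z1 E1 D1] := H1 k; have [z2 E2 D2] := H2 k.
exists (z1 + z2); first by rewrite coefD mulrDr E1 E2 rmorphD.
by move=> ek; rewrite coefD -modzDm D1 // D2 // modzDm.
Qed.

(** When e divides k + 1 the allowed power of 2 grows by one, so the integer numerator doubles;
    hence X reduces to 0. *)
Lemma gauss_reducesX e h g :
  (0 < e)%N -> gauss_reduces e h g -> gauss_reduces e (h * 'X) 0.
Proof.
move=> e0 H [|k].
  by exists 0; rewrite ?coefMX ?mulr0 // => _; rewrite coef0.
have [z E _] := H k; rewrite coefMX /=.
have [ek|ek] := boolP (e %| k.+1)%N; last first.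
  by exists z => //; rewrite -E divnS // (negPf ek).
exists (2 * z).
  by rewrite divnS // ek rmorphM /= -E exprS -mulrA.
by move=> _; rewrite coef0 modzMr.
Qed.

Lemma gauss_reducesW e h g : (0 < e)%N ->
  gauss_reduces e h g -> gauss_reduces e (h * (2^-1 *: 'X^e)) (g * 'X).
Proof.
move=> e0 H k; rewrite -scalerAr coefZ coefMXn.
have [ke|ek] := ltnP k e.
  exists 0; rewrite ?mulr0 // => _; rewrite divn_small // coefMX //=.
have [z E D] := H (k - e)%N; exists z.
  rewrite -E -{1}(subnK ek) divnDr ?divnn ?e0 ?dvdnn // addn1 exprSr.
  by field.
have ekk : (k %/ e = ((k - e) %/ e).+1)%N.
  by rewrite -{1}(subnK ek) divnDr ?divnn ?e0 ?dvdnn // addn1.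
move=> /[dup] dk; rewrite -{1}(subnK ek) dvdn_addl // => /D ->.
by rewrite coefMX ekk.
Qed.

Lemma gauss_reducesC e (c : int) : (0 < e)%N -> gauss_reduces e c%:~R%:P c%:P.
Proof.
move=> e0 [|k]; first by exists c; rewrite ?div0n ?coefC ?mul1r.
exists 0; rewrite coefC ?mulr0 // => /dvdnP[[|j] // ->].
by rewrite mulnK // coefC.
Qed.

Lemma gauss_reduces_ev2 e (P : {poly {poly int}}) : (0 < e)%N ->
  gauss_reduces e (ev2 'X (2^-1 *: 'X^e) P) P`_0.
Proof.
move=> e0; elim/poly_ind: P => [|P p IHP].
  by rewrite rmorph0 coef0; exact: (gauss_reducesC 0).
rewrite coefD coefMX coefC /= rmorphD rmorphM /= ev2X ev2C.
apply: gauss_reducesD; first exact: gauss_reducesX IHP.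
elim/poly_ind: p => [|p c IHp].
  by rewrite map_poly0 horner0; exact: (gauss_reducesC 0).
rewrite rmorphD rmorphM /= map_polyX map_polyC !hornerE /=.
apply: gauss_reducesD; first exact: gauss_reducesW.
by have := gauss_reducesC c e0; rewrite -(rmorph_int polyC).
Qed.

(** Reduction modulo (2, X) is well defined on the subring Z[X, X^e / 2] of Q[X]: its coefficient of
    W^j is read off from 2^j times the coefficient of X^(e j). *)
Lemma ev2_gauss_eq0 e (P : {poly {poly int}}) : (0 < e)%N ->
  ev2 'X (2^-1 *: 'X^e : {poly rat}) P = 0 ->
  ev2 (0 : {poly 'F_2}) 'X P = 0.
Proof.
move=> e0 P0; rewrite ev2_0.
apply/polyP => j; rewrite coef0.
rewrite horner_intX coef_map.
have [z] := gauss_reduces_ev2 P e0 (e * j).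
rewrite P0 coef0 mulr0 dvdn_mulr // mulKn // => /esym/eqP.
rewrite intr_eq0 => /eqP -> /(_ isT)/esym/eqP.
rewrite mod0z => /eqP/dvdz_mod0P; rewrite -intrF2_eq0 => /eqP.
by [].
Qed.

Definition reduction : {poly {poly int}} -> {poly 'F_2} := ev2 0 'X.

HB.instance Definition _ := GRing.RMorphism.copy reduction (ev2 0 'X).

(** W goes to 1 because 1 is the simple nonzero root of the residual polynomial W^s + W^(s+1) of an
    edge. *)
Definition residue : {poly {poly int}} -> 'F_2 := ev2 0 1.

HB.instance Definition _ := GRing.RMorphism.copy residue (ev2 0 1).

Definition gauss_ev (e : nat) : {poly {poly int}} -> {poly rat} :=
  ev2 'X (2^-1 *: 'X^e).

HB.instance Definition _ e :=
  GRing.RMorphism.copy (gauss_ev e) (ev2 'X (2^-1 *: 'X^e)).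

Lemma residueE P : residue P = (reduction P).[1].
Proof.
rewrite -[RHS]/(horner_eval 1 (ev2 0 'X P)) ev2_morph /=.
by rewrite /horner_eval horner0 hornerX.
Qed.

Lemma reduction_eq0 P : reduction P = 0 -> exists A B, P = A * 'X + B *+ 2.
Proof.
rewrite /reduction ev2_0 horner_intX => /map_poly_F2_eq0[q Pq].
move: Pq; elim/poly_ind: P => [|P p _] Pq.
  by exists 0, 0; rewrite mul0r mul0rn addr0.
exists P, q%:P; rewrite -rmorphMn -Pq /=.
by rewrite coefD coefMX coefC add0r.
Qed.

Lemma gauss_evX e : gauss_ev e 'X = 'X.
Proof. exact: ev2X. Qed.

Lemma gauss_ev_2W e : gauss_ev e 'X%:P *+ 2 = 'X^e.
Proof. by rewrite /gauss_ev ev2W scalerMnl -mulr_natr mulVf ?scale1r. Qed.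

(* X generates the prime ideal (2, X) of Z[X, X^e / 2] up to the unit W of the
   localisation, and E is outside of that ideal; so N factors X can be taken
   off the equation one by one. *)
Lemma residue_dvd_eq0 e E Q P s N : (0 < e)%N ->
  reduction E = 'X^s + 'X^(s.+1) :> {poly 'F_2} ->
  gauss_ev e (E * Q) = gauss_ev e ('X^N * P) -> residue P = 0.
Proof.
move=> e0 redE.
have red_eq A B : gauss_ev e A = gauss_ev e B -> reduction A = reduction B.
  move/eqP; rewrite -subr_eq0 -rmorphB => /eqP/(ev2_gauss_eq0 e0)/eqP.
  by rewrite -/(reduction _) rmorphB /= subr_eq0 => /eqP.
elim: N P Q => [|N IHN] P Q /[dup] EQ /red_eq.
  rewrite mul1r residueE => <-; rewrite rmorphM /= redE !hornerE !expr1n.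
  by rewrite [1 + 1](_ : _ = 0) ?mul0r //; apply: val_inj.
rewrite !rmorphM rmorphXn /= redE [reduction 'X]ev2X expr0n /= mul0r => /eqP.
rewrite mulf_eq0 -[X in X + _]mulr1 exprSr -mulrDr mulf_eq0 expf_eq0.
rewrite polyX_eq0 andbF /= => /orP[/eqP X1|/eqP/reduction_eq0[A [B QE]]].
  have := congr1 (fun p : {poly 'F_2} => p.[0]) X1.
  by rewrite !hornerE => /eqP; rewrite oner_eq0.
have -> : residue P = residue ('X%:P * P).
  by rewrite rmorphM /= [residue 'X%:P]ev2W mul1r.
(* Q = A X + 2 B and 2 W = X^e give W Q = X (W A + X^(e-1) B); this is why P was multiplied by W,
   whose residue is 1. *)
apply: (IHN _ ('X%:P * A + 'X^(e.-1) * B)).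
have X0 : gauss_ev e 'X != 0 by rewrite gauss_evX polyX_eq0.
apply: (mulfI X0).
transitivity (gauss_ev e ('X%:P * (E * Q))).
  have XW : gauss_ev e 'X * gauss_ev e 'X^(e.-1) = gauss_ev e 'X%:P *+ 2.
    by rewrite -rmorphM -exprS prednK // rmorphXn /= gauss_evX gauss_ev_2W.
  rewrite QE !(rmorphM, rmorphD, rmorphMn) /=.
  move: XW; move: (gauss_ev e 'X) (gauss_ev e 'X^(e.-1)) (gauss_ev e 'X%:P).
  move=> x x' w XW.
  transitivity (x * gauss_ev e E * w * gauss_ev e A + x * x' * gauss_ev e E * gauss_ev e B).
    by ring.
  by rewrite XW; ring.
by rewrite rmorphM /= EQ -!rmorphM; congr (gauss_ev e _); rewrite exprS; ring.
Qed.

(** * Normalising a polynomial along an edge of its Newton polygon *)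

Lemma exp2_split c v :
  (2 : {poly rat}) ^+ v = 2 ^+ (v - c) * (2^-1 ^+ (c - v))%:P * 2 ^+ c.
Proof.
have two : (2 : {poly rat}) = (2 : rat)%:P by rewrite (rmorph_nat polyC).
have [vc|cv] := leqP v c.
  have /subnK := vc; set d := (c - v)%N => <-.
  rewrite subnDA subnAC subnn sub0n expr0 mul1r exprD mulrA two.
  rewrite -!polyC_exp -!polyCM.
  by rewrite -exprMn mulVf // expr1n mul1r.
by rewrite (eqP (ltnW cv)) expr0 mulr1 -exprD subnK // ltnW.
Qed.

(* The segment from (k0, j0 + 1) to (k0 + e, j0) is an edge of the 2-adic Newton
   polygon of G, and no other coefficient lies on its line. *)
Definition newton_edge (e k0 j0 : nat) (G : {poly int}) : Prop :=
  [/\ exists u, G`_k0 = 2 ^+ j0.+1 * (2 * u + 1),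
      exists u, G`_(k0 + e) = 2 ^+ j0 * (2 * u + 1) &
      forall k, k != k0 -> k != (k0 + e)%N ->
        exists v u, G`_k = 2 ^+ v * u /\ (e * j0.+1 + k0 < e * v + k)%N].

(** After scaling, the endpoints of the edge become W^k0 and W^(k0+1) up to odd factors, while a
    point strictly above the line keeps a factor X or 2. So s = k0. *)
Lemma newton_edge_ev e k0 j0 G : (0 < e)%N -> newton_edge e k0 j0 G ->
  exists s c N E, reduction E = 'X^s + 'X^(s.+1) :> {poly 'F_2} /\
    gauss_ev e E * 2 ^+ c = map_poly intr G * 'X^N.
Proof.
move=> e0 [[u0 G0] [u1 G1] Gk].
(* Solves e (c - v) = k + N at both endpoints (k, v) = (k0, j0 + 1) and (k0 + e, j0). *)
pose c := (j0.+1 + k0)%N; pose N := (e * k0 - k0)%N.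
have ek0 : (k0 <= e * k0)%N by rewrite leq_pmull.
have gX := gauss_evX e.
have gW : gauss_ev e 'X%:P = 2^-1 *: 'X^e by rewrite /gauss_ev ev2W.
have mono k v u i : G`_k = 2 ^+ v * u -> (e * (c - v) + i = k + N)%N ->
    gauss_ev e (u%:~R * 2 ^+ (v - c) * 'X^i * 'X%:P ^+ (c - v)) * 2 ^+ c =
    (G`_k)%:~R * 'X^(k + N).
  move=> -> <-; rewrite !rmorphM !rmorphXn /= gX gW rmorph_int rmorph_nat.
  rewrite exprZn -exprM exprD -!scalerAr -!scalerAl.
  rewrite -[2%:~R]/(2 : {poly rat}).
  rewrite (exp2_split c v).
  rewrite -mul_polyC; move: (_%:P) (2 ^+ (v - c)) (2 ^+ c) u%:~R => x y z t.
  by move: 'X^i 'X^(e * (c - v)) => x' y'; ring.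
have redm (u : int) i j l : reduction (u%:~R * 2 ^+ l * 'X^i * 'X%:P ^+ j) =
    u%:~R * (l == 0)%:R * (i == 0)%:R * 'X^j :> {poly 'F_2}.
  rewrite !rmorphM !rmorphXn /= rmorph_int rmorph_nat.
  rewrite [reduction 'X]ev2X [reduction 'X%:P]ev2W !expr0n.
  rewrite (_ : 2 = 0) ?expr0n // -(rmorph_nat polyC) (_ : 2 = 0) ?rmorph0 //.
  exact: val_inj.
have odd1 (u : int) : (2 * u + 1)%:~R = 1 :> {poly 'F_2}.
  rewrite rmorphD rmorphM /= -(rmorph_int polyC) (_ : 2%:~R = 0) ?mul0r ?add0r //.
  exact: val_inj.
pose R k : {poly 'F_2} := (k == k0)%:R * 'X^k0 + (k == k0 + e)%N%:R * 'X^(k0.+1).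
have Ek k : exists E, reduction E = R k /\
    gauss_ev e E * 2 ^+ c = (G`_k)%:~R * 'X^(k + N).
  rewrite /R; have [->|k_k0] := eqVneq k k0.
    eexists; split; last by apply: (mono _ _ _ 0%N G0); rewrite /c /N; lia.
    have [c1 c2] : (j0.+1 - c = 0 /\ c - j0.+1 = k0)%N by rewrite /c; lia.
    rewrite redm odd1 c1 c2.
    have -> : (k0 == k0 + e)%N = false by lia.
    by rewrite /= !mul1r mul0r addr0.
  have [->|k_k1] := eqVneq k (k0 + e)%N.
    eexists; split; last by apply: (mono _ _ _ 0%N G1); rewrite /c /N; nia.
    have [c1 c2] : (j0 - c = 0 /\ c - j0 = k0.+1)%N by rewrite /c; lia.
    rewrite redm odd1 c1 c2.
    by rewrite /= !mul1r mul0r add0r.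
  have [v [u [Gv ltv]]] := Gk k k_k0 k_k1.
  have le_i : (e * (c - v) <= k + N)%N.
    by rewrite mulnBr leq_subLR /c /N mulnDr; lia.
  eexists; split; last by apply: (mono _ _ _ _ Gv); exact: subnKC le_i.
  rewrite redm !mul0r addr0.
  have [/eqP vc|] := eqVneq (v - c)%N 0%N; last by rewrite mulr0 !mul0r.
  have [/eqP|] := eqVneq (k + N - e * (c - v))%N 0%N; last by rewrite mulr0 !mul0r.
  (* With neither a factor 2 nor a factor X, the point would not be strictly above the line. *)
  rewrite !subn_eq0 in vc * => le2; exfalso.
  have := leq_mul (leqnn e) vc; move: le2 ltv.
  by rewrite mulnBr /c /N mulnDr; lia.
pose n := maxn (size G) (k0 + e).+1.
have [E [redE evE]] : exists E, reduction E = \sum_(k < n) R k /\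
    gauss_ev e E * 2 ^+ c = \sum_(k < n) (G`_k)%:~R * 'X^(k + N).
  elim: n => [|n [E [redE evE]]].
    by exists 0; rewrite !big_ord0 !rmorph0 mul0r.
  have [M [redM evM]] := Ek n; exists (E + M).
  by rewrite !big_ord_recr !rmorphD /= mulrDl redE redM evE evM.
exists k0, c, N, E; split.
  rewrite redE /R big_split /= -!mulr_suml.
  have n0 : (k0 < n)%N by rewrite /n; lia.
  have n1 : (k0 + e < n)%N by rewrite /n; lia.
  rewrite (bigD1 (Ordinal n0)) //= eqxx big1 ?addr0 ?mul1r; last first.
    by move=> i /negPf; rewrite -val_eqE /= => ->.
  rewrite (bigD1 (Ordinal n1)) //= eqxx big1 ?addr0 ?mul1r //.
  by move=> i /negPf; rewrite -val_eqE /= => ->.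
rewrite evE (_ : map_poly _ _ = \poly_(k < n) (G`_k)%:~R); last first.
  apply/polyP => i; rewrite coef_map coef_poly; case: ltnP => // ni.
  by rewrite nth_default ?rmorph0 // (leq_trans _ ni) // leq_maxl.
rewrite poly_def mulr_suml; apply: eq_bigr => k _.
by rewrite -scalerAl -exprD -mul_polyC -(rmorph_int polyC).
Qed.

(** * Places with residue field F_2 *)

(* [T x a]: x lies in the valuation ring and has residue a. *)
Record place (K : fieldType) (T : K -> 'F_2 -> Prop) : Prop := Place {
  place1 : T 1 1;
  placeD : forall x y a b, T x a -> T y b -> T (x + y) (a + b);
  placeM : forall x y a b, T x a -> T y b -> T (x * y) (a * b);
  place_fun : forall x a b, T x a -> T x b -> a = b;
  place_total : forall x, (exists a, T x a) \/ T x^-1 0 }.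

Section PlaceOfKernel.
Variables (K : fieldType) (t w : K) (e s : nat) (E : {poly {poly int}}).
Hypothesis two_neq0 : 2 != 0 :> K.
Hypothesis e_gt0 : (0 < e)%N.
Hypothesis w2 : w * 2 = t ^+ e.
Hypothesis ker_residue : forall P, ev2 t w P = 0 -> residue P = 0.
Hypothesis reductionE : reduction E = 'X^s + 'X^(s.+1) :> {poly 'F_2}.
Hypothesis E_root : ev2 t w E = 0.

(* The localisation of Z[t, w] at the kernel of t -> 0, w -> 1. *)
Definition kernel_place (x : K) (a : 'F_2) : Prop :=
  exists P Q, [/\ residue Q = 1, residue P = a & x * ev2 t w Q = ev2 t w P].

Local Notation T := kernel_place.

(** Satisfied when K = Q[t]: odd denominators have residue 1, so only powers of 2 have to be
    cleared. *)
Hypothesis exp2_dom : forall x, exists M a, T (2 ^+ M * x) a.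

Let dom x := exists a, T x a.

Lemma kernel_place_ev2 P : T (ev2 t w P) (residue P).
Proof. by exists P, 1; rewrite !rmorph1 mulr1. Qed.

Lemma kernel_placeD x y a b : T x a -> T y b -> T (x + y) (a + b).
Proof.
move=> [P [Q [Q1 Pa Ex]]] [P' [Q' [Q1' Pa' Ex']]].
exists (P * Q' + P' * Q), (Q * Q'); split.
- by rewrite rmorphM /= Q1 Q1' mulr1.
- by rewrite rmorphD !rmorphM /= Q1 Q1' Pa Pa' !mulr1.
by rewrite rmorphD !rmorphM /= -Ex -Ex'; ring.
Qed.

Lemma kernel_placeM x y a b : T x a -> T y b -> T (x * y) (a * b).
Proof.
move=> [P [Q [Q1 Pa Ex]]] [P' [Q' [Q1' Pa' Ex']]].
exists (P * P'), (Q * Q'); split.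
- by rewrite rmorphM /= Q1 Q1' mulr1.
- by rewrite rmorphM /= Pa Pa'.
by rewrite !rmorphM /= -Ex -Ex'; ring.
Qed.

Lemma kernel_place_fun x a b : T x a -> T x b -> a = b.
Proof.
move=> [P [Q [Q1 <- Ex]]] [P' [Q' [Q1' <- Ex']]].
have : residue (P * Q' - P' * Q) = 0.
  by apply: ker_residue; rewrite rmorphB !rmorphM /= -Ex -Ex'; ring.
by rewrite rmorphB !rmorphM /= Q1 Q1' !mulr1 => /eqP; rewrite subr_eq0 => /eqP.
Qed.

Lemma kernel_placeV x : T x 1 -> T x^-1 1.
Proof.
move=> [P [Q [Q1 P1 Ex]]]; exists Q, P; split=> //.
have [x0|x0] := eqVneq x 0; last by rewrite -Ex mulKf.
have /ker_residue/eqP : ev2 t w P = 0 by rewrite -Ex x0 mul0r.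
by rewrite P1 oner_eq0.
Qed.

Lemma kernel_placeX x a n : T x a -> T (x ^+ n) (a ^+ n).
Proof.
move=> Tx; elim: n => [|n IHn]; last by rewrite !exprS; exact: kernel_placeM.
by have := kernel_place_ev2 1; rewrite !rmorph1.
Qed.

Lemma kernel_place_int (n : int) : T n%:~R n%:~R.
Proof. by have := kernel_place_ev2 n%:~R; rewrite !rmorph_int. Qed.

Lemma kernel_place_t : T t 0.
Proof. by have := kernel_place_ev2 'X; rewrite ev2X [residue 'X]ev2X. Qed.

Lemma kernel_place_w : T w 1.
Proof. by have := kernel_place_ev2 'X%:P; rewrite ev2W [residue 'X%:P]ev2W. Qed.

Let w_neq0 : w != 0.
Proof.
apply/eqP => w0; have := kernel_place_fun (kernel_place_int 0) _.
by rewrite !mulr0z => /(_ 1); rewrite -{1}w0 => /(_ kernel_place_w)/eqP; rewrite eq_sym oner_eq0.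
Qed.

Let t_neq0 : t != 0.
Proof.
apply: contraNneq w_neq0 => t0.
by have /eqP := w2; rewrite t0 expr0n eqn0Ngt e_gt0 /= mulf_eq0 (negPf two_neq0) orbF.
Qed.

Let domD x y : dom x -> dom y -> dom (x + y).
Proof. by move=> [a Tx] [b Ty]; exists (a + b); exact: kernel_placeD. Qed.

Let domM x y : dom x -> dom y -> dom (x * y).
Proof. by move=> [a Tx] [b Ty]; exists (a * b); exact: kernel_placeM. Qed.

Let dom_int n : dom n%:~R.
Proof. by exists n%:~R; exact: kernel_place_int. Qed.

Let domV x : T x 1 -> dom x^-1.
Proof. by move=> /kernel_placeV Tx; exists 1. Qed.

Let dom_w : dom w. Proof. by exists 1; exact: kernel_place_w. Qed.

Let dom_ev2 P : dom (ev2 t w P).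
Proof. by exists (residue P); exact: kernel_place_ev2. Qed.

Let dom_2t : dom (2 / t).
Proof.
have -> : 2 / t = t ^+ e.-1 * w^-1.
  apply: (mulfI w_neq0); rewrite mulrA w2 mulrCA mulfV // mulr1.
  by rewrite -{1}(prednK e_gt0) exprS mulrAC mulfV // mul1r.
apply: domM; last exact: domV kernel_place_w.
by exists (0 ^+ e.-1); exact: kernel_placeX kernel_place_t.
Qed.

(** As [E] reduces to W^s (W + 1), the equation E(t, w) = 0 puts w^s (w + 1) in the ideal (t, 2); in
    the localisation w is a unit and t divides 2. *)
Let dom_1wt : dom ((w + 1) / t).
Proof.
have /reduction_eq0[A [B EAB]] : reduction ('X%:P ^+ s * ('X%:P + 1) - E) = 0.
  rewrite rmorphB rmorphM rmorphXn rmorphD /= rmorph1 reductionE.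
  by rewrite [reduction 'X%:P]ev2W exprS; ring.
have := congr1 (ev2 t w) EAB.
rewrite rmorphB !rmorphD !rmorphM rmorphXn rmorphD /= rmorph1 E_root ev2W ev2X.
rewrite subr0 => Ew.
have -> : (w + 1) / t = (w^-1) ^+ s * (ev2 t w A + 2 / t * ev2 t w B).
  apply: (mulfI (expf_neq0 s w_neq0)); rewrite mulrA Ew [RHS]mulrA -exprMn mulfV //.
  by rewrite expr1n mul1r; field.
apply: domM.
  by exists (1 ^+ s); apply: kernel_placeX; exact: kernel_placeV kernel_place_w.
by apply: domD => //; apply: domM.
Qed.

(** Modulo t, w is congruent to -1 by [dom_1wt], so every element of Z[t, w] is congruent to an
    integer. *)
Let dom_divt P : exists2 n : int, residue P = n%:~R & dom ((ev2 t w P - n%:~R) / t).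
Proof.
elim/poly_ind: P => [|P p _].
  exists 0; first by rewrite rmorph0.
  by rewrite rmorph0 subrr mul0r; exact: (dom_int 0).
have [n pn Dn] : exists2 n : int, residue p%:P = n%:~R &
    dom (((ev2 t w p%:P) - n%:~R) / t).
  elim/poly_ind: p => [|p c [n pn Dn]].
    exists 0; first by rewrite rmorph0.
    by rewrite rmorph0 subrr mul0r; exact: (dom_int 0).
  exists (c - n).
    rewrite rmorphB /= -pn !polyCD !polyCM rmorphD rmorphM /= [residue 'X%:P]ev2W.
    rewrite [residue c%:P%:P]ev2C map_polyC hornerC mulr1 addrC.
    by have [->|->] := F2_cases (residue p%:P); congr (_ + _); exact: val_inj.
  rewrite !polyCD !polyCM rmorphD rmorphM /= ev2W [ev2 t w c%:P%:P]ev2C map_polyC hornerC.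
  have -> : (ev2 t w p%:P * w + c%:~R - (c - n)%:~R) / t =
     (ev2 t w p%:P - n%:~R) / t * w + n%:~R * ((w + 1) / t).
    by rewrite rmorphB /=; field.
  by apply: domD; apply: domM.
exists n; first by rewrite rmorphD rmorphM /= [residue 'X]ev2X mulr0 add0r.
have -> : (ev2 t w (P * 'X + p%:P) - n%:~R) / t =
    ev2 t w P + (ev2 t w p%:P - n%:~R) / t.
  by rewrite rmorphD rmorphM /= ev2X; field.
exact: domD.
Qed.

(** The numerator is congruent modulo t to an even integer, and t divides 2. *)
Lemma kernel_place_uniformizer x : T x 0 -> dom (x / t).
Proof.
move=> [P [Q [Q1 P0 Ex]]]; have [n Pn Dn] := dom_divt P.
have /dvdzP[m n2] : (2 %| n)%Z by rewrite -intrF2_eq0 -Pn P0.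
have TQ : T (ev2 t w Q) 1 by rewrite -Q1; exact: kernel_place_ev2.
have Q0 : ev2 t w Q != 0.
  by apply/eqP => /ker_residue/eqP; rewrite Q1 oner_eq0.
have -> : x / t = ((ev2 t w P - n%:~R) / t + m%:~R * (2 / t)) * (ev2 t w Q)^-1.
  by rewrite n2 rmorphM /= -Ex -[2%:~R]/(2 : K); field; rewrite Q0 t_neq0.
by apply: domM (domV TQ); apply: domD => //; apply: domM.
Qed.

(** Factors t are taken off x as long as its residue is 0. At most N can be: once N reaches 0, x y
    has residue 1, hence so does x. *)
Lemma kernel_place_valuation N x y : dom x -> dom y -> T (x * y / t ^+ N) 1 ->
  exists k, T (x / t ^+ k) 1.
Proof.
elim: N x => [|N IHN] x [a Tx] Dy Txy; have [a0|a1] := F2_cases a.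
- have [b Ty] := Dy; have := kernel_placeM Tx Ty.
  rewrite a0 mul0r; move: Txy; rewrite expr0 divr1 => Txy.
  by move/(kernel_place_fun Txy)/eqP; rewrite oner_eq0.
- by exists 0%N; rewrite expr0 divr1 -a1.
- rewrite a0 in Tx; have [] := IHN _ (kernel_place_uniformizer Tx) Dy.
    by move: Txy; rewrite exprS invfM; congr (T _ _); ring.
  by move=> k Tk; exists k.+1; rewrite exprS invfM mulrA.
by exists 0%N; rewrite expr0 divr1 -a1.
Qed.

Lemma kernel_placeP : place T.
Proof.
split; first by have := kernel_place_int 1.
- exact: kernel_placeD.
- exact: kernel_placeM.
- exact: kernel_place_fun.
move=> x; have [->|x0] := eqVneq x 0.
  by right; rewrite invr0; exact: (kernel_place_int 0).
have [M1 Dx] := exp2_dom x; have [M2 Dy] := exp2_dom x^-1.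
have two : 2 = t ^+ e / w by rewrite -w2 mulrC mulKf.
(* 2^M1 x and 2^M2 / x have product 2^(M1 + M2), which is t^(e (M1 + M2)) up to a power of the unit
   w. *)
have [|k] := @kernel_place_valuation (e * (M1 + M2)) _ _ Dx Dy.
  rewrite (_ : _ / _ = (w^-1) ^+ (M1 + M2)).
    by rewrite -(expr1n _ (M1 + M2)); apply: kernel_placeX; exact: kernel_placeV kernel_place_w.
  rewrite mulrACA mulfV // mulr1 -exprD two expr_div_n -exprM mulrAC mulfV ?mul1r ?exprVn //.
  by rewrite expf_neq0.
rewrite two expr_div_n -exprM -exprVn => Tk.
have {}Tk : T (x * t ^+ (e * M1) / t ^+ k) 1.
  rewrite -[1]mulr1 -{2}(expr1n _ M1).
  have -> : x * t ^+ (e * M1) / t ^+ k =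
     t ^+ (e * M1) * w^-1 ^+ M1 * x / t ^+ k * w ^+ M1.
    have -> : t ^+ (e * M1) * w^-1 ^+ M1 * x / t ^+ k * w ^+ M1 =
       x * t ^+ (e * M1) / t ^+ k * (w^-1 * w) ^+ M1 by rewrite exprMn; ring.
    by rewrite mulVf // expr1n mulr1.
  by apply: kernel_placeM => //; apply: kernel_placeX; exact: kernel_place_w.
(* x is t^(k - e M1) times a unit. Equality goes to the left, since the right alternative demands
   residue 0 of the inverse. *)
have [kM|Mk] := leqP (e * M1) k.
  left; exists (0 ^+ (k - e * M1)); rewrite -[0 ^+ _]mul1r.
  rewrite (_ : x = x * t ^+ (e * M1) / t ^+ k * t ^+ (k - e * M1)).
    by apply: kernel_placeM => //; apply: kernel_placeX kernel_place_t.
  have /subnK {1}<- := kM; rewrite exprD; field.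
  by rewrite !expf_neq0.
right; rewrite (_ : x^-1 = (x * t ^+ (e * M1) / t ^+ k)^-1 * t ^+ (e * M1 - k)).
  rewrite (_ : 0 = 1 * 0 ^+ (e * M1 - k)); last first.
    by rewrite expr0n subn_eq0 leqNgt Mk mulr0.
  apply: kernel_placeM; first exact: kernel_placeV.
  exact: kernel_placeX kernel_place_t.
have /subnK {1}<- := ltnW Mk; rewrite exprD; field.
by rewrite !expf_neq0.
Qed.

End PlaceOfKernel.

(** * The place attached to an edge *)

Lemma int_odd_F2 (n : int) : (2 %| n)%Z = false -> n%:~R = 1 :> 'F_2.
Proof. by have [|//] := F2_cases n%:~R => /eqP; rewrite intrF2_eq0 => ->. Qed.

Lemma int_exp2_odd (a : int) : a != 0 ->
  exists M o, a = 2 ^+ M * o /\ o%:~R = 1 :> 'F_2.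
Proof.
rewrite -absz_gt0 => a0; have [m cm am] := @pfactor_coprime 2 _ isT a0.
exists (logn 2 `|a|), ((-1) ^+ (a < 0)%R * m%:Z); split.
  rewrite mulrCA [a in LHS]intEsign; congr (_ * _).
  by rewrite [X in Posz X]am PoszM mulrC -!natz natrX.
apply: int_odd_F2; rewrite dvdzE abszMsign /= dvdn2.
by apply/negbTE; rewrite negbK -coprime2n.
Qed.

Section PlaceExists.
Variables (K : fieldExtType rat) (t : K) (G : {poly int}) (e k0 j0 : nat).
Hypothesis e_gt0 : (0 < e)%N.
Hypothesis G_edge : newton_edge e k0 j0 G.
Hypothesis G_min : forall H : {poly rat},
  (map_poly (in_alg K) H).[t] = 0 <-> map_poly intr G %| H.
Hypothesis t_gen : forall x, exists H : {poly rat}, x = (map_poly (in_alg K) H).[t].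

Lemma exists_place : exists T : K -> 'F_2 -> Prop,
  [/\ place T, T t 0 & T (t ^+ e / 2) 1].
Proof.
have two0 : 2 != 0 :> K by rewrite -[2]/(2%:R) -(rmorph_nat (in_alg K)) fmorph_eq0.
pose iota : {rmorphism {poly rat} -> K} := horner_eval t \o map_poly (in_alg K).
have iotaX : iota 'X = t by rewrite /= map_polyX /horner_eval hornerX.
pose w := t ^+ e / 2.
have w2 : w * 2 = t ^+ e by rewrite /w; field.
have iota_w : iota (2^-1 *: 'X^e) = w.
  rewrite -mul_polyC rmorphM rmorphXn iotaX /w mulrC; congr (_ * _).
  apply: (mulIf two0); rewrite mulVf // -(rmorph_nat iota 2) -rmorphM.
  by rewrite -(rmorph_nat polyC) -polyCM mulVf // rmorph1.
have ev P : ev2 t w P = iota (gauss_ev e P) by rewrite ev2_morph iotaX iota_w.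
have [s [c [N [E [redE evE]]]]] := newton_edge_ev e_gt0 G_edge.
have G0 : iota (map_poly intr G) = 0 by apply/G_min.
have E0 : ev2 t w E = 0.
  have := congr1 iota evE; rewrite !rmorphM G0 mul0r rmorphXn rmorph_nat -ev.
  by move/eqP; rewrite mulf_eq0 expf_eq0 (negPf two0) andbF orbF => /eqP.
have gpoly (q : {poly int}) : gauss_ev e (map_poly polyC q) = map_poly intr q.
  by rewrite /gauss_ev ev2_map -[RHS]comp_polyXr horner_intX comp_polyXr.
have ker P : ev2 t w P = 0 -> residue P = 0.
  rewrite ev => /G_min/dvdpP[q Eq].
  have [q' [a a0 Eq']] := rat_poly_scale q.
  have [M [o [Ea o1]]] := int_exp2_odd a0.
  rewrite -[LHS]mulr1 -o1 -(rmorph_int residue) -rmorphM.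
  (* With q = q' / a and a = 2^M o, the power 2^M is absorbed by X^(e M) = (2 W)^M, and the odd o
     has residue 1. *)
  apply: (@residue_dvd_eq0 e E ('X%:P ^+ M * 2 ^+ c * map_poly polyC q') _ s (e * M + N)) => //.
  have gW := gauss_ev_2W e.
  have qa : q * (2 ^+ M * o%:~R) = map_poly intr q'.
    rewrite Eq' -[X in _ * X](_ : a%:~R%:P = _).
      by rewrite mulrC mul_polyC scalerA mulfV ?intr_eq0 // scale1r.
    by rewrite (rmorph_int polyC) Ea rmorphM rmorphXn.
  rewrite !rmorphM !rmorphXn rmorph_int /= gpoly gauss_evX rmorph_nat exprD exprM.
  rewrite -gW -qa Eq.
  transitivity (gauss_ev e E * 2 ^+ c * (gauss_ev e 'X%:P ^+ M) * (q * (2 ^+ M * o%:~R))).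
    by ring.
  rewrite evE -(mulr_natr (gauss_ev e 'X%:P)) exprMn.
  by move: (o%:~R) (gauss_ev e 'X%:P ^+ M) (2 ^+ M) => x y z; ring.
exists (kernel_place t w); split.
- apply: (kernel_placeP two0 e_gt0 w2 ker redE E0) => x.
  have [H ->] := t_gen x; have [q [a a0 ->]] := rat_poly_scale H.
  have [M [o [Ea o1]]] := int_exp2_odd a0.
  exists M, (residue (map_poly polyC q)), (map_poly polyC q), o%:~R; split=> //.
    by rewrite rmorph_int.
  rewrite rmorph_int ev gpoly mulrAC mulrC.
  transitivity (iota (a%:~R^-1 *: map_poly intr q) * iota a%:~R).
    by congr (_ * _); rewrite rmorph_int Ea rmorphM rmorphXn.
  rewrite -rmorphM -scalerAl mulrC -(rmorph_int polyC) mul_polyC scalerA.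
  by rewrite mulVf ?intr_eq0 // scale1r.
- exact: kernel_place_t.
exact: kernel_place_w.
Qed.

End PlaceExists.

(** * Places, integral elements and centres *)

Section PlaceTheory.
Variables (K : fieldType) (T : K -> 'F_2 -> Prop).
Hypothesis TP : place T.

(** The axioms of a place do not mention opposites: totality gives -1 a residue, as -1 is its own
    inverse, and its square 1 rules out 0. *)
Lemma placeN1 : T (- 1) 1.
Proof.
have [a Ta] : exists a, T (- 1) a.
  by case: (place_total TP (- 1)) => //; rewrite invrN1 => T0; exists 0.
have [a0|a1] := F2_cases a; last by rewrite -a1.
have := placeM TP Ta Ta; rewrite mulrNN mulr1 a0 mul0r => T10.
by have /eqP := place_fun TP (place1 TP) T10; rewrite oner_eq0.
Qed.

Lemma place0 : T 0 0.
Proof.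
have := placeD TP (place1 TP) placeN1; rewrite subrr.
by rewrite [1 + 1](_ : _ = 0) //; exact: val_inj.
Qed.

Lemma placeN x a : T x a -> T (- x) a.
Proof. by move=> /(placeM TP placeN1); rewrite mulN1r mul1r. Qed.

Lemma place_int (n : int) : T n%:~R n%:~R.
Proof.
elim: n => [|n IHn|n IHn]; first exact: place0.
  by rewrite -addn1 PoszD !rmorphD /=; apply: placeD TP _ _ _ _ IHn (place1 TP).
rewrite -addn1 PoszD opprD !rmorphD /=.
apply: placeD TP _ _ _ _ IHn _.
by rewrite rmorphN1 (_ : (-1)%:~R = 1); [exact: placeN1 | exact: val_inj].
Qed.

Lemma placeD0 x y : T x 0 -> T y 0 -> T (x + y) 0.
Proof. by move=> Tx Ty; rewrite -[0]addr0; exact: (placeD TP). Qed.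

Lemma placeM0 x y a : T x a -> T y 0 -> T (x * y) 0.
Proof. by move=> Tx Ty; rewrite -(mulr0 a); exact: (placeM TP). Qed.

Lemma placeX x a n : T x a -> T (x ^+ n) (a ^+ n).
Proof.
move=> Tx; elim: n => [|n IHn]; first exact: (place1 TP).
by rewrite !exprS; exact: (placeM TP).
Qed.

Lemma place_horner (p : {poly int}) x a :
  T x a -> T (map_poly intr p).[x] (map_poly intr p).[a].
Proof.
move=> Tx; elim/poly_ind: p => [|p c IHp]; first by rewrite !map_poly0 !horner0; exact: place0.
rewrite !rmorphD !rmorphM /= !map_polyX !map_polyC /= !hornerE.
by apply: (placeD TP) (place_int c); apply: (placeM TP).
Qed.

(** A valuation ring is integrally closed: if 1 / x had residue 0, the monic equation divided by x^d
    would give -1 the residue 0. *)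
Lemma place_integral x : integralOver (intr : int -> K) x -> exists a, T x a.
Proof.
move=> [p mon_p px]; have [//|Tx] := place_total TP x.
(* Since 0^-1 = 0, the second alternative of totality carries no information at 0. *)
have [x0|x0] := eqVneq x 0; first by exists 0; rewrite x0; exact: place0.
have p0 : (0 < size p)%N by rewrite size_poly_gt0 monic_neq0.
pose d := (size p).-1.
have Tsum : T (\sum_(i < d) (p`_i)%:~R * x ^+ i / x ^+ d) 0.
  apply: (big_ind (fun y => T y 0)) => [|y z Ty Tz|[i ltid] _ /=]; first exact: place0.
    exact: placeD0.
  rewrite -mulrA (_ : _ / _ = x^-1 * x^-1 ^+ (d - i.+1)).
    by apply: placeM0 (place_int _) _; rewrite mulrC; exact: placeM0 (placeX _ Tx) Tx.
  have /subnK {1}<- := ltid; rewrite -exprS exprVn addnS -addSn exprD.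
  by field; rewrite !expf_neq0.
have : \sum_(i < d) (p`_i)%:~R * x ^+ i / x ^+ d = - 1.
  move: px; rewrite /root horner_coef size_map_poly_id0; last first.
    by rewrite (monicP mon_p) oner_eq0.
  rewrite -(prednK p0) big_ord_recr /= -/d coef_map -/(lead_coef p) (monicP mon_p) mul1r.
  rewrite addr_eq0 => /eqP sumE; rewrite -mulr_suml.
  under eq_bigr do rewrite -coef_map.
  by rewrite sumE mulNr mulfV // expf_neq0.
move=> sumE; rewrite sumE in Tsum.
by have /eqP := place_fun TP placeN1 Tsum; rewrite oner_eq0.
Qed.

End PlaceTheory.

(** With a = A[_n.+1, multiplying A(x) = 0 by a^n gives a monic equation of degree n + 1 for a x,
    with coefficients a^(n - i) A]_i. Only a bound on the size is assumed, so a may be 0. *)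
Lemma integral_lead_root (R K : comNzRingType) (f : {rmorphism R -> K}) (A : {poly K}) n x :
  (size A <= n.+2)%N -> (forall i, integralOver f A`_i) -> root A x ->
  integralOver f (A`_n.+1 * x).
Proof.
move=> szA intA /eqP Ax; set a := A`_n.+1.
pose C := \poly_(i < n.+1) (a ^+ (n - i) * A`_i); pose B := 'X^(n.+1) + C.
have szC : (size C <= n.+1)%N by exact: size_poly.
have intX k : integralOver f (a ^+ k).
  elim: k => [|k IHk]; first exact: integral1.
  by rewrite exprS; exact: integral_mul (intA _) IHk.
have monB : B \is monic.
  by rewrite monicE lead_coefDl ?lead_coefXn // size_polyXn ltnS.
apply: (integral_root_monic monB).
  rewrite /root hornerD hornerXn horner_poly.
  have : a ^+ n * A.[x] = 0 by rewrite Ax mulr0.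
  rewrite (horner_coef_wide _ szA) mulr_sumr big_ord_recr /= -/a => A0.
  apply/eqP; rewrite addrC -[RHS]A0; congr (_ + _); last first.
    by rewrite exprMn exprS; ring.
  apply: eq_bigr => -[i /= ltin] _; have /subnK {2}<- : (i <= n)%N by rewrite -ltnS.
  by rewrite exprMn exprD; ring.
move=> _ /(nthP 0)[i _ <-]; rewrite coefD coefXn coef_poly.
apply: integral_add; first exact: integral_nat.
by case: ifP => _; [exact: integral_mul | exact: integral0].
Qed.

Section SameCenter.
Variables (K : fieldExtType rat) (T T' : K -> 'F_2 -> Prop).
Hypotheses (TP : place T) (TP' : place T').
Hypothesis agree : forall z, integralOver (intr : int -> K) z ->
  forall a, T z a -> T' z a.

(** Let a be the top coefficient; a and a x are integral. If a had residue 1 at T, hence at T', then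
    a x would have residue 1 at T and 0 at T', against [agree]. So both have residue 0 at T, and
    subtracting a X^n (X - x) lowers the degree. *)
Lemma place_coef_eq0 (A : {poly K}) x : T x 1 -> T' x 0 -> root A x ->
  (forall i, integralOver (intr : int -> K) A`_i) -> forall i, T A`_i 0.
Proof.
move=> Tx Tx'; have [n] := ubnP (size A); elim: n A => // n IHn A szA rA intA i.
rewrite ltnS in szA; case: n szA IHn => [|[|n]] szA IHn.
- by rewrite nth_default; [exact: place0 | exact: leq_trans szA _].
- by move: rA; rewrite (size1_polyC szA) rootC => /eqP ->; rewrite coef0; exact: place0.
set a := A`_n.+1.
have intax : integralOver (intr : int -> K) (a * x).
  exact: integral_lead_root.
have Ta : T a 0.
  have [b Tb] := place_integral TP (intA n.+1).
  have [<- //|b1] := F2_cases b; rewrite b1 in Tb.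
  have T0 := placeM0 TP' (agree (intA _) Tb) Tx'.
  have := placeM TP Tb Tx; rewrite mulr1 => /(agree intax) T1.
  by have /eqP := place_fun TP' T0 T1; rewrite eq_sym oner_eq0.
have Tax : T (a * x) 0 by rewrite mulrC; exact: placeM0 Tx Ta.
pose A' := A - a *: 'X^n * ('X - x%:P).
have A'E j : A'`_j = A`_j - (j == n.+1)%:R * a + (j == n)%:R * (a * x).
  rewrite coefB -scalerAl coefZ mulrBr coefB -exprSr coefXn coefMC coefXn.
  by case: eqP => _; case: eqP => _; rewrite /=; ring.
have T_A' j : T A'`_j 0.
  apply: IHn.
  - apply/leq_sizeP => k nk; rewrite A'E.
    have -> : (k == n) = false by lia.
    have [->|kn] := eqVneq k n.+1; first by rewrite -/a /=; ring.
    by rewrite /= !mul0r subr0 addr0 nth_default // (leq_trans szA) //; lia.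
  - by rewrite /root hornerD hornerN hornerM hornerXsubC subrr mulr0 subr0.
  move=> k; rewrite A'E; apply: integral_add.
    exact: integral_sub (intA k) (integral_mul (integral_nat _ _) (intA n.+1)).
  exact: integral_mul (integral_nat _ _) intax.
have -> : A`_i = A'`_i + ((i == n.+1)%:R * a - (i == n)%:R * (a * x)).
  by rewrite A'E; ring.
apply: (placeD0 TP) => //; apply: (placeD0 TP); last apply: (placeN TP).
  exact: placeM0 TP _ _ _ (place_int TP (i == n.+1)) Ta.
exact: placeM0 TP _ _ _ (place_int TP (i == n)) Tax.
Qed.

(* A place is determined by its centre on the ring of integers. *)
Lemma place_same_center x : T x 1 -> ~ T' x 0.
Proof.
move=> Tx Tx'.
have /polyOver1P[h hE] := minPolyOver 1%AS x.
have h0 : h != 0.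
  have := monic_neq0 (monic_minPoly 1%AS x); apply: contraNneq => h0.
  by rewrite hE h0 map_poly0.
have [q [a a0 hq]] := rat_poly_scale h.
have q0 : q != 0 by apply: contraNneq h0 => q0; rewrite hq q0 map_poly0 scaler0.
pose A : {poly K} := map_poly intr (zprimitive q).
have rA : root A x.
  have := root_minPoly 1%AS x; rewrite hE hq map_polyZ /= -map_poly_comp.
  rewrite (eq_map_poly (g := intr)) => [|z /=]; last by rewrite scaler_int.
  rewrite rootZ; last by rewrite scaler_eq0 oner_eq0 orbF invr_eq0 intr_eq0.
  rewrite {1}[q]zpolyEprim map_polyZ rootZ //.
  rewrite -[X in X != 0]/((zcontents q)%:~R : K).
  by rewrite -(rmorph_int (in_alg K)) fmorph_eq0 intr_eq0 zcontents_eq0.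
(* Every coefficient of the primitive integer multiple of the minimal polynomial becomes even, which
   contradicts primitivity. *)
have even i : (2 %| (zprimitive q)`_i)%Z.
  rewrite -intrF2_eq0; apply/eqP/(place_fun TP (place_int TP _)).
  rewrite -coef_map; apply: place_coef_eq0 Tx Tx' rA _ i => j.
  by rewrite coef_map; exact: integral_id.
have : (2 %| zcontents (zprimitive q))%Z.
  by rewrite dvdz_contents; apply/polyOverP => i; exact: even.
by rewrite zcontents_primitive q0.
Qed.

End SameCenter.

(** * Group index *)

Section GroupIndexTheory.
Variables (V : zmodType) (A B : set V).
Hypothesis AD : forall x y, A x -> A y -> A (x + y).
Hypothesis BB : forall x y, B x -> B y -> B (x - y).
Hypothesis B0 : B 0.

(* Translation by z permutes the cosets, so the sum of a system of
   representatives changes by an element of B. *)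
Lemma mulrn_group_index z : A z -> B (z *+ group_index A B).
Proof.
move=> Az; rewrite /group_index.
(* An infinite index counts as 0, and z *+ 0 = 0 lies in B. *)
have [finS|infS] := pselect (finite_set (cosets A B)); last first.
  by rewrite /fset_set; case: pselect => // _; rewrite cardfs0 mulr0n.
pose tr (u : V) (C : set V) : set V := [set u + y | y in C].
have trK u : cancel (tr u) (tr (- u)).
  move=> C; apply/seteqP; split=> [_ [_ [y Cy <-] <-]|y Cy].
    by rewrite addKr.
  by exists (u + y); [exists y | rewrite addKr].
pose S := fset_set (cosets A B).
have inS C : (C \in S) = (C \in cosets A B) by rewrite in_fset_set.
have trS u C : A u -> C \in S -> tr u C \in S.
  move=> Au; rewrite !inS !inE => -[x Ax <-]; exists (u + x); first exact: AD.
  apply/seteqP; split=> [_ [y By <-]|_ [_ [y By <-] <-]].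
    by exists (x + y); [exists y | rewrite addrA].
  by exists y; rewrite ?addrA.
have permS : perm_eq [seq tr z C | C <- S] S.
  have uS := fset_uniq S.
  have uT : uniq [seq tr z C | C <- S] by rewrite map_inj_uniq //; exact: can_inj (trK z).
  apply: uniq_perm => //.
  have sub : {subset [seq tr z C | C <- S] <= S}.
    by move=> _ /mapP[C CS ->]; exact: trS.
  by have [|_] := uniq_min_size uT sub; rewrite ?size_map.
(* On S the default 0 is never reached: a coset x + B contains x because B contains 0. *)
pose rep (C : set V) : V := xget 0 C.
have repS C : C \in S -> B (rep (tr z C) - rep C - z).
  rewrite inS inE => -[x Ax Cx].
  have [y By] : exists2 y, B y & rep C = x + y.
    rewrite /rep; case: xgetP => [c ->|/(_ (x + 0))].
      by rewrite -Cx => -[y By <-]; exists y.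
    by rewrite -Cx => -[]; exists 0.
  have [y' By'] : exists2 y', B y' & rep (tr z C) = z + (x + y').
    rewrite /rep; case: xgetP => [c ->|/(_ (z + (x + 0)))].
      by rewrite -Cx => -[_ [y' By' <-] <-]; exists y'.
    by rewrite -Cx => -[]; exists (x + 0) => //; exists 0.
  move=> -> ->; rewrite (_ : _ - z = y' - y); first exact: BB.
  by rewrite addrC addrA addKr opprD addrACA subrr add0r.
have BN x : B x -> B (- x) by move=> Bx; rewrite -sub0r; exact: BB.
have BD x y : B x -> B y -> B (x + y).
  by move=> Bx By; rewrite -[y]opprK; apply: BB => //; exact: BN.
have : B (\sum_(C <- S) (rep (tr z C) - rep C - z)).
  by rewrite big_seq; apply: (big_ind B).
rewrite !sumrB -(big_map (tr z) xpredT rep) (perm_big _ permS) /= subrr sub0r.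
move=> /BN; rewrite opprK big_const_seq count_predT.
by rewrite iter_addr_0.
Qed.

End GroupIndexTheory.

(** * The Newton polygon of the shifted trinomial *)

(** From k C(2^r, k) = 2^r C(2^r - 1, k - 1), since k < 2^i has 2-adic valuation at most i - 1. *)
Lemma dvdn_bin_exp2 r i k : (0 < k < 2 ^ i)%N -> (i <= r)%N ->
  (2 ^ (r - i).+1 %| 'C(2 ^ r, k))%N.
Proof.
move=> /andP[k0 ki] ir; have [o co ko] := @pfactor_coprime 2 k isT k0.
set v := logn 2 k in ko.
have vi : (v < i)%N.
  rewrite -(ltn_exp2l _ _ (isT : 1 < 2)%N) (leq_ltn_trans _ ki) // dvdn_leq //.
  by rewrite ko dvdn_mull.
have vr : (v <= r)%N by lia.
have : (2 ^ r %| k * 'C(2 ^ r, k))%N.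
  by rewrite -[k in 'C(_, k)](prednK k0) -[k in X in (k * X)%N](prednK k0)
    -{1}(prednK k0) -mul_bin_diag dvdn_mulr.
rewrite {1}ko -(subnKC vr) expnD mulnAC [X in (_ %| X)%N]mulnC dvdn_pmul2l ?expn_gt0 //.
rewrite subnKC // Gauss_dvdr ?coprimeXl //.
by apply: dvdn_trans; apply: dvdn_exp2l; lia.
Qed.

(** By Pascal's rule, neighbours in row 2^r - 1 add up to an even entry of row 2^r, so oddness
    propagates from C(2^r - 1, 0) = 1. *)
Lemma odd_bin_exp2_pred r j : (j < 2 ^ r)%N -> odd 'C((2 ^ r).-1, j).
Proof.
elim: j => [|j IHj] jr; first by rewrite bin0.
have := @dvdn_bin_exp2 r r j.+1 jr (leqnn r).
rewrite subnn -{1}(prednK (expn_gt0 2 r)) binS dvdn2 oddD.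
by rewrite IHj ?(ltnW jr) // addbT negbK.
Qed.

Lemma bin_exp2_exact r i : (i <= r)%N ->
  exists2 u, 'C(2 ^ r, 2 ^ i) = (2 ^ (r - i) * u)%N & odd u.
Proof.
move=> ir; exists 'C((2 ^ r).-1, (2 ^ i).-1); last first.
  by apply: odd_bin_exp2_pred; rewrite prednK ?expn_gt0 // leq_exp2l.
have i0 : (0 < 2 ^ i)%N by rewrite expn_gt0.
apply/eqP; rewrite -(eqn_pmul2l i0) mulnA -expnD subnKC //.
by rewrite mul_bin_diag prednK.
Qed.

Lemma oddz_split (u : int) : ~~ (2 %| u)%Z -> exists v, u = 2 * v + 1.
Proof.
by move=> u2; exists (u %/ 2)%Z; lia.
Qed.

Section TrinomialEdges.
Variables (r : nat) (a b eps : int).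
Hypothesis eps1 : eps = 1 \/ eps = - 1.
Hypothesis r_gt0 : (0 < r)%N.

Definition shifted_trinomial : {poly int} := trinomial r a b \Po ('X + eps%:P).
Local Notation G := shifted_trinomial.

Lemma coef_shifted_trinomial k :
  G`_k = eps ^+ (2 ^ r - k) *+ 'C(2 ^ r, k) + (k == 1)%N%:R * a
         + (k == 0)%N%:R * (eps * a + b).
Proof.
rewrite /G /trinomial !rmorphD /= comp_Xn_poly comp_polyZ comp_polyX comp_polyC.
rewrite !coefD coefZ !coefC coefD coefX coefC.
have -> : (('X + eps%:P) ^+ (2 ^ r))`_k = eps ^+ (2 ^ r - k) *+ 'C(2 ^ r, k).
  rewrite addrC exprDn coef_sum.
  have coef_i i : (eps%:P ^+ (2 ^ r - i) * 'X^i *+ 'C(2 ^ r, i))`_k =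
      (k == i)%:R * (eps ^+ (2 ^ r - i) *+ 'C(2 ^ r, i)).
    by rewrite coefMn -polyC_exp coefCM coefXn mulrC mulrnAr.
  under eq_bigr do rewrite coef_i.
  have [kr|rk] := ltnP k (2 ^ r).+1.
    rewrite (bigD1 (Ordinal kr)) //= eqxx mul1r big1 ?addr0 // => i.
    by rewrite -val_eqE eq_sym /= => /negPf ->; rewrite mul0r.
  rewrite bin_small // mulr0n big1 // => -[i /= ir] _.
  by rewrite (_ : (k == i) = false) ?mul0r //; lia.
by case: k => [|[|k]] /=; ring.
Qed.

Lemma exp_sign n : eps ^+ n = 1 \/ eps ^+ n = - 1.
Proof.
case: eps1 => ->; first by left; rewrite expr1n.
by rewrite -signr_odd; case: (odd n); [right | left].
Qed.

Lemma odd_exp_sign n : odd n -> eps ^+ n = eps.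
Proof. by case: eps1 => -> n1; rewrite ?expr1n // -signr_odd n1. Qed.

Lemma even_exp_sign n : ~~ odd n -> eps ^+ n = 1.
Proof. by case: eps1 => -> n1; rewrite ?expr1n // -signr_odd (negPf n1). Qed.

Lemma coef0_shifted_trinomial : G`_0 = 1 + eps * a + b.
Proof.
rewrite coef_shifted_trinomial bin0 mulr1n mul0r mul1r addr0 subn0 addrA.
by rewrite even_exp_sign // oddX eqn0Ngt r_gt0.
Qed.

Lemma coef1_shifted_trinomial : G`_1 = 2 ^+ r * eps + a.
Proof.
rewrite coef_shifted_trinomial bin1 mul1r mul0r addr0; congr (_ + _).
rewrite odd_exp_sign; last by rewrite oddB ?expn_gt0 // oddX eqn0Ngt r_gt0.
by rewrite -mulr_natl natrX.
Qed.

Lemma coef_shifted_trinomial_gt1 k : (1 < k)%N ->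
  G`_k = eps ^+ (2 ^ r - k) *+ 'C(2 ^ r, k).
Proof. by case: k => [|[|k]] // _; rewrite coef_shifted_trinomial /=; ring. Qed.

Lemma coef_shifted_trinomial_dvd i k : (1 < k < 2 ^ i)%N -> (i <= r)%N ->
  exists u, G`_k = 2 ^+ (r - i).+1 * u.
Proof.
move=> /andP[k1 ki] ir; rewrite coef_shifted_trinomial_gt1 //.
have /dvdnP[u ->] := @dvdn_bin_exp2 r i k (introT andP (conj (ltnW k1) ki)) ir.
exists (u%:R * eps ^+ (2 ^ r - k)).
by rewrite -mulr_natr natrM natrX; ring.
Qed.

Lemma coef_shifted_trinomial_exact i : (0 < i <= r)%N ->
  exists u, G`_(2 ^ i) = 2 ^+ (r - i) * (2 * u + 1).
Proof.
move=> /andP[i0 ir]; rewrite coef_shifted_trinomial_gt1; last by rewrite (ltn_exp2l 0).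
have [u -> u1] := bin_exp2_exact ir.
have [v uv] : exists v : int, eps ^+ (2 ^ r - 2 ^ i) * u%:R = 2 * v + 1.
  apply: oddz_split; case: (exp_sign (2 ^ r - 2 ^ i)) => ->; move: u1; rewrite ?mul1r ?mulN1r; lia.
by exists v; rewrite -uv -mulr_natr natrM natrX; ring.
Qed.

Lemma trunc_log2_bounds k : (0 < k)%N -> exists j, (2 ^ j <= k < 2 ^ j.+1)%N.
Proof. by move=> k0; exists (trunc_log 2 k); exact: trunc_log_bounds. Qed.

(** The edge from (2^i, r - i) to (2^(i+1), r - i - 1), inherited from (X + eps)^(2^r); a and b only
    affect the points at 0 and 1, which must stay above the line. For i = 0 the point at 1 is the
    left endpoint, so its valuation has to be exact. *)
Lemma newton_edge_pow i : (i < r)%N ->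
  (if i == 0%N then exists u, G`_1 = 2 ^+ r * (2 * u + 1)
   else exists u, G`_1 = 2 ^+ (r - i).+1 * u) ->
  (exists u, G`_0 = 2 ^+ (r - i).+2 * u) ->
  newton_edge (2 ^ i) (2 ^ i) (r - i).-1 G.
Proof.
move=> ir G1 G0; have ri : (r - i).-1.+1 = (r - i)%N by lia.
have i0 : (0 < 2 ^ i)%N by rewrite expn_gt0.
split.
- rewrite ri; case: (posnP i) G1 => [-> /=|i_gt0 _]; first by rewrite expn0 subn0.
  by apply: coef_shifted_trinomial_exact; rewrite i_gt0 ltnW.
- rewrite addnn -mul2n -expnS -subnS; apply: coef_shifted_trinomial_exact.
  by rewrite ltnS /= ir.
move=> k ki ki2; rewrite ri.
have [k0|] := posnP k.
  by have [u Gu] := G0; exists (r - i).+2, u; rewrite k0; split=> //; nia.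
rewrite leq_eqVlt => /orP[/eqP k1|k1].
  case: eqP G1 => [i00|_ [u Gu]].
    by move: ki; rewrite -k1 i00.
  by exists (r - i).+1, u; rewrite -k1; split=> //; nia.
have [k_lt|k_ge] := ltnP k (2 ^ i).
  have [u Gu] := @coef_shifted_trinomial_dvd i k (introT andP (conj k1 k_lt)) (ltnW ir).
  by exists (r - i).+1, u; split=> //; nia.
have [j /andP[jk kj]] := trunc_log2_bounds (ltnW k1).
have ij : (i <= j)%N by rewrite -ltnS -(ltn_exp2l _ _ (isT : 1 < 2)%N) (leq_ltn_trans k_ge).
(* This is 2^d >= d + 1 for d = j - i; equality, at d = 0 and d = 1, gives only the two excluded
   endpoints. *)
have bound : (2 ^ i * (j - i).+1 < k)%N.
  have [ji|ji] := eqVneq j i.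
    by rewrite ji subnn muln1 ltn_neqAle eq_sym ki.
  have jE : (2 ^ j = 2 ^ i * 2 ^ (j - i))%N by rewrite -expnD subnKC.
  have [ji1|ji1] := eqVneq j i.+1.
    rewrite ji1 subSnn muln2 -addnn ltn_neqAle eq_sym ki2 /=.
    by rewrite (leq_trans _ jk) // ji1 expnS mul2n addnn.
  rewrite (leq_trans _ jk) // jE ltn_pmul2l //.
  have -> : (j - i = (j - i - 2).+2)%N by lia.
  elim: (j - i - 2)%N => // d IHd; rewrite expnS; lia.
have [jr|rj] := ltnP j r.
  have [u Gu] := @coef_shifted_trinomial_dvd j.+1 k (introT andP (conj k1 kj)) jr.
  exists (r - j)%N, u; split; first by rewrite Gu subnSK.
  have -> : (r - i = r - j + (j - i))%N by lia.
  by nia.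
by exists 0%N, G`_k; rewrite mul1r; split=> //; nia.
Qed.

(** The edge from (1, r - i + 1) to (2^i, r - i), present when a lowers the valuation at 1 below the
    value r it has for (X + eps)^(2^r). *)
Lemma newton_edge_tail i : (1 < i < r)%N ->
  (exists u, G`_1 = 2 ^+ (r - i).+1 * (2 * u + 1)) ->
  (exists u, G`_0 = 2 ^+ (r - i).+2 * u) ->
  newton_edge (2 ^ i).-1 1 (r - i) G.
Proof.
move=> /andP[i1 ir] G1 G0.
have i4 : (4 <= 2 ^ i)%N by exact: (@leq_pexp2l 2 2 i).
split=> //.
  by rewrite add1n prednK ?expn_gt0 //; apply: coef_shifted_trinomial_exact; lia.
move=> k k1 ki; have {}ki : k != (2 ^ i)%N by move: ki; lia.
have [k0|] := posnP k.
  by have [u Gu] := G0; exists (r - i).+2, u; rewrite k0; split=> //; nia.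
rewrite leq_eqVlt eq_sym (negPf k1) /= => {}k1.
have [k_lt|k_ge] := ltnP k (2 ^ i).
  have [u Gu] := @coef_shifted_trinomial_dvd i k (introT andP (conj k1 k_lt)) (ltnW ir).
  by exists (r - i).+1, u; split=> //; nia.
have [j /andP[jk kj]] := trunc_log2_bounds (ltnW k1).
have ij : (i <= j)%N by rewrite -ltnS -(ltn_exp2l _ _ (isT : 1 < 2)%N) (leq_ltn_trans k_ge).
have bound : ((2 ^ i).-1 * (j - i).+1 + 1 < k)%N.
  have jE : (2 ^ j = 2 ^ i * 2 ^ (j - i))%N by rewrite -expnD subnKC.
  have := ltn_expl (j - i) (isT : 1 < 2)%N; move: (2 ^ (j - i))%N jE => x jE dx.
  have [ji|ji] := eqVneq j i; first by move: ki; rewrite ji subnn muln1; lia.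
  rewrite (leq_trans _ jk) // jE; nia.
have [jr|rj] := ltnP j r.
  have [u Gu] := @coef_shifted_trinomial_dvd j.+1 k (introT andP (conj k1 kj)) jr.
  exists (r - j)%N, u; split; first by rewrite Gu subnSK.
  have -> : (r - i = r - j + (j - i))%N by lia.
  by nia.
by exists 0%N, G`_k; rewrite mul1r; split=> //; nia.
Qed.

(** The line is v + k = 3: at k = 2, 3 the valuation is at least r - 1 >= 2, and k >= 4 lies beyond
    it. *)
Lemma newton_edge_linear : (2 < r)%N ->
  (exists u, G`_1 = 2 ^+ 2 * (2 * u + 1)) ->
  (exists u, G`_0 = 2 ^+ 3 * (2 * u + 1)) ->
  newton_edge 1 0 2 G.
Proof.
move=> r2 G1 G0; split=> // k k0 k1; have {k0 k1}k1 : (1 < k)%N by lia.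
have r8 : (8 <= 2 ^ r)%N by exact: (@leq_pexp2l 2 3 r).
have [k4|k4] := ltnP k 4.
  have [u Gu] := @coef_shifted_trinomial_dvd 2 k (introT andP (conj k1 k4)) (ltnW r2).
  by exists (r - 2).+1, u; split=> //; lia.
by exists 0%N, G`_k; rewrite mul1r; split=> //; lia.
Qed.

End TrinomialEdges.

(** * Three edges under each of the conditions *)

Definition has_edge e G : Prop := exists k0 j0, newton_edge e k0 j0 G.

Definition three_edges G : Prop := exists e1 e2 e3,
  [&& 0 < e1, e1 < e2 & e2 < e3]%N /\
  [/\ has_edge e1 G, has_edge e2 G & has_edge e3 G].

Lemma exp2_factor r k : (k <= r)%N -> exists u : int, 2 ^+ r = 2 ^+ k * u.
Proof. by move=> kr; exists (2 ^+ (r - k)); rewrite -exprD subnKC. Qed.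

Lemma three_edges_case1 (r : nat) (a b : int) :
  (3 <= r)%N -> (a = 4 %[mod 8])%Z -> (b = 3 %[mod 8])%Z ->
  exists eps, three_edges (shifted_trinomial r a b eps).
Proof.
move=> r3 a4 b3; have [u r8] := exp2_factor r3.
have [eps [eps1 [v Gv]]] : exists eps : int, (eps = 1 \/ eps = - 1) /\
    exists v, 1 + eps * a + b = 2 ^+ 3 * (2 * v + 1).
  (* Both values are multiples of 8 and differ by 2 a, which is 8 modulo 16, so exactly one of them
     is 8 modulo 16. *)
  have [h|h] : (1 + a + b = 8 %[mod 16])%Z \/ (1 - a + b = 8 %[mod 16])%Z by lia.
    by exists 1; split; [left | exists ((1 + a + b) %/ 16)%Z; lia].
  by exists (-1); split; [right | exists ((1 - a + b) %/ 16)%Z; lia].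
have r_gt0 : (0 < r)%N by lia.
have G0 := coef0_shifted_trinomial a b eps1 r_gt0.
have G1 := coef1_shifted_trinomial a b eps1 r_gt0.
have G1e : exists u, (shifted_trinomial r a b eps)`_1 = 2 ^+ 2 * (2 * u + 1).
  by exists ((2 ^+ r * eps + a) %/ 8)%Z; rewrite G1 r8; case: eps1 => ->; lia.
have r1 : (r - r.-1 = 1)%N by lia.
have m4 : (2 ^ 2 <= 2 ^ r.-1)%N by rewrite leq_exp2l //; lia.
(* The edges join (0, 3), (1, 2), (2^(r-1), 1), (2^r, 0). *)
exists eps, 1%N, (2 ^ r.-1).-1, (2 ^ r.-1)%N; split; first by lia.
split.
- by exists 0%N, 2%N; apply: newton_edge_linear => //; exists v; rewrite G0.
- exists 1%N, (r - r.-1)%N; apply: newton_edge_tail => //; rewrite ?r1 //; first by lia.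
  by exists (2 * v + 1); rewrite G0.
exists (2 ^ r.-1)%N, (r - r.-1).-1; apply: newton_edge_pow => //; first by lia.
  rewrite (_ : (r.-1 == 0)%N = false) ?r1; last by lia.
  by have [w ->] := G1e; exists (2 * w + 1).
by rewrite r1; exists (2 * v + 1); rewrite G0.
Qed.

Lemma three_edges_case2 (r : nat) (a b : int) :
  (4 <= r)%N -> (a = 8 %[mod 16])%Z -> (b = 7 %[mod 16])%Z ->
  three_edges (shifted_trinomial r a b 1).
Proof.
move=> r4 a8 b7; have [u r16] := exp2_factor r4.
have r_gt0 : (0 < r)%N by lia.
have eps1 : (1 : int) = 1 \/ (1 : int) = - 1 by left.
have G0 := coef0_shifted_trinomial a b eps1 r_gt0.
have G1 := coef1_shifted_trinomial a b eps1 r_gt0.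
have [v Gv] : exists v, 1 + 1 * a + b = 2 ^+ 4 * v.
  by exists ((1 + a + b) %/ 16)%Z; lia.
have [w Gw] : exists w, 2 ^+ r * 1 + a = 2 ^+ 3 * (2 * w + 1).
  by exists ((2 ^+ r + a) %/ 16)%Z; rewrite r16; lia.
have r1 : (r - r.-1 = 1)%N by lia.
have r2 : (r - r.-2 = 2)%N by lia.
have q4 : (2 ^ 2 <= 2 ^ r.-2)%N by rewrite leq_exp2l //; lia.
have qm : (2 ^ r.-2 < 2 ^ r.-1)%N by rewrite ltn_exp2l //; lia.
(* The edges join (1, 3), (2^(r-2), 2), (2^(r-1), 1), (2^r, 0). *)
exists (2 ^ r.-2).-1, (2 ^ r.-2)%N, (2 ^ r.-1)%N; split; first by lia.
split.
- exists 1%N, (r - r.-2)%N; apply: newton_edge_tail => //; rewrite ?r2; first by lia.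
    by exists w; rewrite G1.
  by exists v; rewrite G0.
- exists (2 ^ r.-2)%N, (r - r.-2).-1; apply: newton_edge_pow => //; rewrite ?r2; first by lia.
    rewrite (_ : (r.-2 == 0)%N = false); last by lia.
    by exists (2 * w + 1); rewrite G1.
  by exists v; rewrite G0.
exists (2 ^ r.-1)%N, (r - r.-1).-1; apply: newton_edge_pow => //; rewrite ?r1; first by lia.
  rewrite (_ : (r.-1 == 0)%N = false); last by lia.
  by exists (2 * (2 * w + 1)); rewrite G1 Gw; ring.
by exists (2 * v); rewrite G0 Gv; ring.
Qed.

Lemma three_edges_case3 (r : nat) (a b : int) : (3 <= r)%N ->
  (a = 0 %[mod 32])%Z /\ (b = 31 %[mod 32])%Z \/
  (a = 16 %[mod 32])%Z /\ (b = 15 %[mod 32])%Z ->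
  three_edges (shifted_trinomial r a b 1).
Proof.
move=> r3 ab; have [u r8] := exp2_factor r3.
have r_gt0 : (0 < r)%N by lia.
have eps1 : (1 : int) = 1 \/ (1 : int) = - 1 by left.
have G0 := coef0_shifted_trinomial a b eps1 r_gt0.
have G1 := coef1_shifted_trinomial a b eps1 r_gt0.
have [v Gv] : exists v, 1 + 1 * a + b = 2 ^+ 5 * v.
  by exists ((1 + a + b) %/ 32)%Z; case: ab => -[]; lia.
have [w Gw] : exists w, 2 ^+ r * 1 + a = 2 ^+ 3 * w.
  by exists ((2 ^+ r + a) %/ 8)%Z; rewrite r8; case: ab => -[]; lia.
have r1 : (r - r.-1 = 1)%N by lia.
have r2 : (r - r.-2 = 2)%N by lia.
have r33 : (r - (r - 3) = 3)%N by lia.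
(* The edges join (2^(r-3), 3), (2^(r-2), 2), (2^(r-1), 1), (2^r, 0). *)
exists (2 ^ (r - 3))%N, (2 ^ r.-2)%N, (2 ^ r.-1)%N; split.
  by rewrite expn_gt0 !ltn_exp2l //; lia.
split.
- exists (2 ^ (r - 3))%N, (r - (r - 3)).-1; apply: newton_edge_pow => //; rewrite ?r33; first by lia.
    (* For r = 3 the leftmost endpoint is at 1, where 8 + a has valuation exactly 3 because 16
       divides a. *)
    case: ifP => r_eq3; rewrite G1.
      have -> : r = 3%N by lia.
      by exists (a %/ 16)%Z; case: ab => -[]; lia.
    have [|u' r16] := @exp2_factor r 4; first by lia.
    by exists ((2 ^+ r + a) %/ 16)%Z; rewrite r16; case: ab => -[]; lia.
  by exists v; rewrite G0.
- exists (2 ^ r.-2)%N, (r - r.-2).-1; apply: newton_edge_pow => //; rewrite ?r2; first by lia.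
    rewrite (_ : (r.-2 == 0)%N = false); last by lia.
    by exists w; rewrite G1.
  by exists (2 * v); rewrite G0 Gv; ring.
exists (2 ^ r.-1)%N, (r - r.-1).-1; apply: newton_edge_pow => //; rewrite ?r1; first by lia.
  rewrite (_ : (r.-1 == 0)%N = false); last by lia.
  by exists (2 * w); rewrite G1 Gw; ring.
by exists (4 * v); rewrite G0 Gv; ring.
Qed.

(** * Three places *)

Section ThreePlaces.
Variable K : fieldExtType rat.
Implicit Types (T : K -> 'F_2 -> Prop) (eta t z : K).

(** Covers both conclusions of the theorem: d = 1 when Z_K = Z[eta], and d = [ind eta] when that
    number is odd. *)
Definition odd_index eta : Prop :=
  forall z, ring_of_integers z -> exists (d : int) (p : {poly int}),
    d%:~R = 1 :> 'F_2 /\ z * d%:~R = (map_poly intr p).[eta].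

(** An odd d has residue 1, so the residue of z at either place is p(a). *)
Lemma odd_index_agree eta T T' a : odd_index eta -> place T -> place T' ->
  T eta a -> T' eta a ->
  forall z, integralOver (intr : int -> K) z -> forall b, T z b -> T' z b.
Proof.
move=> eta_odd TP TP' Ta Ta' z intz b Tb.
have [d [p [d1 zE]]] := eta_odd z intz.
have value T0 c : place T0 -> T0 eta a -> T0 z c -> c = (map_poly intr p).[a].
  move=> T0P T0a T0c; apply: (place_fun T0P (x := z * d%:~R)).
    by rewrite -[c]mulr1 -d1; apply: (placeM T0P) => //; exact: place_int.
  by rewrite zE; exact: place_horner.
have [b' Tb'] := place_integral TP' intz.
by rewrite (value T b) // -(value T' b').
Qed.

(** t^e / 2 is t^e' / 2 times a positive power of t, so it has residue 0 at T' and 1 at T, although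
    the two places have the same centre. *)
Lemma odd_index_edges eta t T T' a e e' : odd_index eta -> place T -> place T' ->
  T eta a -> T' eta a -> T' t 0 -> (e' < e)%N ->
  T (t ^+ e / 2) 1 -> ~ T' (t ^+ e' / 2) 1.
Proof.
move=> eta_odd TP TP' Ta Ta' Tt' ee Te Te'.
apply: (place_same_center TP TP' (odd_index_agree eta_odd TP TP' Ta Ta') Te).
have /subnK <- := ee; rewrite addnS -addSn addnC exprD mulrAC exprS.
rewrite (mulrC t); exact: (placeM0 TP' Te' (placeM0 TP' (placeX TP' _ Tt') Tt')).
Qed.

Lemma three_edges_index_even t (G : {poly int}) eta :
  (forall H : {poly rat}, (map_poly (in_alg K) H).[t] = 0 <-> map_poly intr G %| H) ->
  (forall x, exists H : {poly rat}, x = (map_poly (in_alg K) H).[t]) ->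
  three_edges G -> ring_of_integers eta -> ~ odd_index eta.
Proof.
move=> G_min t_gen [e1 [e2 [e3 [/and3P[e1_gt0 e12 e23]]]]].
move=> [[k1 [j1 N1]] [k2 [j2 N2]] [k3 [j3 N3]]] int_eta eta_odd.
have e2_gt0 := ltn_trans e1_gt0 e12; have e3_gt0 := ltn_trans e2_gt0 e23.
have [T1 [P1 T1t T1e]] := exists_place e1_gt0 N1 G_min t_gen.
have [T2 [P2 T2t T2e]] := exists_place e2_gt0 N2 G_min t_gen.
have [T3 [P3 T3t T3e]] := exists_place e3_gt0 N3 G_min t_gen.
have [a1 E1] := place_integral P1 int_eta.
have [a2 E2] := place_integral P2 int_eta.
have [a3 E3] := place_integral P3 int_eta.
have [a12|a12] := eqVneq a1 a2.
  by rewrite -a12 in E2; exact: (odd_index_edges eta_odd P2 P1 E2 E1 T1t e12 T2e T1e).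
have [a23|a23] := eqVneq a2 a3.
  by rewrite -a23 in E3; exact: (odd_index_edges eta_odd P3 P2 E3 E2 T2t e23 T3e T2e).
have a13 : a1 = a3.
  by move: a12 a23; have [->|->] := F2_cases a1; have [->|->] := F2_cases a2;
     have [->|->] := F2_cases a3.
rewrite -a13 in E3.
exact: (odd_index_edges eta_odd P3 P1 E3 E1 T1t (ltn_trans e12 e23) T3e T1e).
Qed.

End ThreePlaces.

(** * The shifted generator theta - eps *)

Lemma shifted_trinomial_min (r : nat) (a b eps : int) (K : fieldExtType rat) (theta : K)
    (H : {poly rat}) :
  irreducible_poly (map_poly (intr : int -> rat) (trinomial r a b)) ->
  root (map_poly (intr : int -> K) (trinomial r a b)) theta ->
  (map_poly (in_alg K) H).[theta - eps%:~R] = 0 <->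
    map_poly intr (shifted_trinomial r a b eps) %| H.
Proof.
set F := trinomial r a b => F_irr F_theta.
have algE (p : {poly int}) : map_poly (in_alg K) (map_poly intr p) = map_poly intr p.
  by rewrite -map_poly_comp; apply: eq_map_poly => c /=; rewrite scaler_int.
have GE : map_poly intr (shifted_trinomial r a b eps) =
    map_poly (intr : int -> rat) F \Po ('X + (eps%:~R)%:P).
  by rewrite map_comp_poly rmorphD /= map_polyX map_polyC.
split=> [H0|/dvdpP[q ->]].
  have -> : H = (H \Po ('X - (eps%:~R)%:P)) \Po ('X + (eps%:~R)%:P).
    by rewrite -comp_polyA comp_polyB comp_polyX comp_polyC addrK comp_polyXr.
  (* If the irreducible F did not divide H(X - eps), the two would be coprime, yet theta is a common
     root. *)
  rewrite GE; apply: dvdp_comp_poly; apply: contraT => ndvd.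
  have : coprimep (map_poly intr F) (H \Po ('X - (eps%:~R)%:P)).
    by rewrite irreducible_poly_coprime.
  rewrite -(coprimep_map (in_alg K)) algE => /coprimep_root /(_ F_theta).
  rewrite map_comp_poly rmorphB /= map_polyX map_polyC /= scaler_int.
  by rewrite horner_comp !hornerE H0 eqxx.
rewrite GE rmorphM /= hornerM map_comp_poly algE horner_comp.
have -> : map_poly (in_alg K) ('X + (eps%:~R)%:P) = 'X + (eps%:~R)%:P.
  by rewrite rmorphD /= map_polyX map_polyC /= scaler_int.
by rewrite !hornerE subrK (eqP F_theta) mulr0.
Qed.

Lemma generates_shift (K : fieldExtType rat) (theta : K) (c : int) :
  generates theta -> forall x, exists H : {poly rat},
    x = (map_poly (in_alg K) H).[theta - c%:~R].
Proof.
move=> K_theta x; have : x \in <<1; theta>>%VS by rewrite K_theta memvf.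
move=> /Fadjoin_polyP[_ /polyOver1P[q ->] ->]; exists (q \Po ('X + (c%:~R)%:P)).
rewrite map_comp_poly horner_comp rmorphD /= map_polyX map_polyC /= scaler_int.
by rewrite !hornerE subrK.
Qed.

Theorem theorem1p6 (r : nat) (a b : int) (K : fieldExtType rat) (theta : K)
    (r_gt0 : (0 < r)%N)
    (F_irr : irreducible_poly (map_poly (intr : int -> rat) (trinomial r a b)))
    (F_theta : root (map_poly (intr : int -> K) (trinomial r a b)) theta)
    (K_theta : generates theta)
    (conds :
       [\/ [/\ (3 <= r)%N, (a = 4 %[mod 8])%Z & (b = 3 %[mod 8])%Z],
           [/\ (4 <= r)%N, (a = 8 %[mod 16])%Z & (b = 7 %[mod 16])%Z]
         | (3 <= r)%N /\
           ((a = 0 %[mod 32])%Z /\ (b = 31 %[mod 32])%Z \/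
            (a = 16 %[mod 32])%Z /\ (b = 15 %[mod 32])%Z)]) :
  prime_common_index_divisor K 2 /\ ~ monogenic K.
have [eps G_edges] : exists eps, three_edges (shifted_trinomial r a b eps).
  case: conds => [[]|[]|[]]; first exact: three_edges_case1.
    by move=> *; exists 1; exact: three_edges_case2.
  by move=> *; exists 1; exact: three_edges_case3.
have not_odd (eta : K) : ring_of_integers eta -> ~ odd_index eta.
  apply: three_edges_index_even G_edges; last exact: (generates_shift eps K_theta).
  by move=> H; exact: shifted_trinomial_min.
have Zadjoin0 (eta : K) : Zadjoin eta 0 by exists 0; rewrite ?map_poly0 ?horner0.
have ZadjoinB (eta x y : K) : Zadjoin eta x -> Zadjoin eta y -> Zadjoin eta (x - y).
  by move=> [p _ <-] [q _ <-]; exists (p - q); rewrite ?rmorphB ?hornerD ?hornerN.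
split; last first.
  (* Using d = 1 directly avoids deriving K = Q(eta) from Z_K = Z[eta]. *)
  move=> [eta int_eta OE]; apply: (not_odd eta int_eta) => z.
  rewrite OE => -[p _ <-]; exists 1, p; split; first exact: val_inj.
  by rewrite mulr1.
split=> //.
have ind_even (eta : K) : ring_of_integers eta -> (2 %| ind eta)%N.
  move=> int_eta; apply: contraT => ind_odd; exfalso.
  apply: (not_odd eta int_eta) => z int_z.
  have int_add (x y : K) : ring_of_integers x -> ring_of_integers y ->
      ring_of_integers (x + y) by exact: integral_add.
  have := mulrn_group_index int_add (@ZadjoinB eta) (Zadjoin0 eta) int_z; move=> [].
  move=> p _ pE; exists (ind eta)%:Z, p; split; last by rewrite pE /ind -pmulrn mulr_natr.
  by apply: int_odd_F2; apply/negbTE.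
(* In the second branch [gcd_set] has its default value 0, which 2 divides. *)
rewrite /field_index /gcd_set; case: xgetP => [d _ [_ gcd_d]|//].
by apply: gcd_d => _ [eta [int_eta _] <-]; exact: ind_even.
Qed.
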